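(* Let $a\in\mathbb{R}^p$. Then $a$ is group invertible if and only if $a\in a^2\odot\mathbb{R}^p$. Moreover, if $a=x\odot a^2=a^2\odot y$ for some $x,y\in\mathbb{R}^p$, then the group inverse of $a$ is $$a^{\#}=x\odot a\odot y=x^2\odot a=a\odot y^2 .$$
   Context: $\mathbb{R}^p$ denotes the commutative ring with unity $(\mathbb{R}^p,+,\odot)$, where $+$ is entrywise addition and $a\odot b=\mathrm{circ}(a)\,b$, with $\mathrm{circ}(a)$ the circulant matrix whose first column is $a$; that is, $(a\odot b)_i=\sum_{j=1}^p a_{i-j+1}b_j$ with indices taken modulo $p$ in $\{1,\dots,p\}$. The unity is $(1,0,\dots,0)^T$. Here $u^2=u\odot u$ and $u\odot\mathbb{R}^p=\{u\odot x:x\in\mathbb{R}^p\}$. An element $z\in\mathbb{R}^p$ is a group inverse of $a$ if $a\odot z\odot a=a$, $z\odot a\odot z=z$ and $a\odot z=z\odot a$; it is unique if it exists and is denoted $a^{\#}$. The element $a$ is called group invertible if $a^{\#}$ exists. *)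

(* Defs.v *)
From mathcomp Require Import all_boot all_order all_algebra.
From mathcomp Require Import boolp classical_sets reals.

Set Implicit Arguments.
Unset Strict Implicit.
Unset Printing Implicit Defensive.

Import GRing.Theory.
Local Open Scope ring_scope.
Local Open Scope classical_set_scope.

(* The space R^n, n >= 1, is 'cV[R]_p.+1 with n = p.+1.  Indices run from 0, and
   [i - j] is the subtraction of the additive group 'I_p.+1, that is, modulo
   the dimension. *)
Definition circ (R : realType) (p : nat) (a : 'cV[R]_p.+1) : 'M[R]_p.+1 :=
  \matrix_(i, j) a (i - j) 0.

Definition circmul (R : realType) (p : nat) (a b : 'cV[R]_p.+1) :
  'cV[R]_p.+1 := circ a *m b.

Notation "a \odot b" := (circmul a b)
  (at level 40, left associativity) : ring_scope.

Definition circsqr (R : realType) (p : nat) (u : 'cV[R]_p.+1) :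
  'cV[R]_p.+1 := u \odot u.

Definition circ_ideal (R : realType) (p : nat) (u : 'cV[R]_p.+1) :
  set 'cV[R]_p.+1 := [set u \odot x | x in [set: 'cV[R]_p.+1]].

Definition is_group_inverse (R : realType) (p : nat) (a z : 'cV[R]_p.+1) :
  Prop :=
  [/\ a \odot z \odot a = a, z \odot a \odot z = z & a \odot z = z \odot a].

Definition group_invertible (R : realType) (p : nat) (a : 'cV[R]_p.+1) :
  Prop := exists z, is_group_inverse a z.

(* The group inverse as a total function, with value 0 when [a] is not group
   invertible.  Uniqueness is [is_group_inverse_uniq]. *)
Definition group_inverse (R : realType) (p : nat) (a : 'cV[R]_p.+1) :
  'cV[R]_p.+1 := xget 0 [set z | is_group_inverse a z].

Section CircRing.
Variables (R : realType) (p : nat).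
Implicit Types a b c z : 'cV[R]_p.+1.

Lemma circmulE a b i :
  (a \odot b) i 0 = \sum_(j < p.+1) a (i - j) 0 * b j 0.
Proof. by rewrite mxE; apply: eq_bigr => j _; rewrite mxE. Qed.

Lemma circmulC a b : a \odot b = b \odot a.
Proof.
apply/matrixP => i j; rewrite (ord1 j) !circmulE.
rewrite (reindex_inj (inv_inj (subKr i))) /=.
by apply: eq_bigr => k _; rewrite subKr mulrC.
Qed.

Lemma circM a b : circ (a \odot b) = circ a *m circ b.
Proof.
apply/matrixP => i j; rewrite mxE circmulE mxE.
rewrite (reindex_inj (addIr (- j))) /=.
apply: eq_bigr => k _; rewrite !mxE; congr (a _ _ * _).
by rewrite opprB addrA subrK.
Qed.

Lemma circmulA a b c : a \odot (b \odot c) = a \odot b \odot c.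
Proof. by rewrite {3}/circmul circM /circmul mulmxA. Qed.

Lemma circmulDl a b c : (a + b) \odot c = a \odot c + b \odot c.
Proof.
rewrite /circmul -mulmxDl; congr (_ *m _).
by apply/matrixP => i j; rewrite !mxE.
Qed.

Lemma circ1mul a : delta_mx 0 0 \odot a = a.
Proof.
rewrite /circmul [circ _](_ : _ = 1%:M) ?mul1mx //.
by apply/matrixP => i j; rewrite !mxE eqxx andbT subr_eq0.
Qed.

Lemma is_group_inverse_uniq a z z' :
  is_group_inverse a z -> is_group_inverse a z' -> z = z'.
Proof.
move=> [aza zaz az] [az'a z'az' az'].
have e : a \odot z = a \odot z'.
  rewrite -{1}az'a -circmulA circmulC circmulA.
  by rewrite aza.
by rewrite -zaz -circmulA e circmulA -az e az' z'az'.
Qed.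

Lemma group_inverseP a : group_invertible a ->
  is_group_inverse a (group_inverse a).
Proof. by move=> [z az]; rewrite /group_inverse; apply: xgetPex; exists z. Qed.

End CircRing.

(* Main.v *)
Require Import Defs.
From mathcomp Require Import all_boot all_order all_algebra.
From mathcomp Require Import boolp classical_sets reals.

Local Open Scope ring_scope.

(** The ring is commutative, so an equation [a = x \odot a^2] says that
    [e = x \odot a] fixes [a].  Such an [e] is idempotent, because
    [e \odot e = x \odot (a \odot e) = x \odot a = e].  It is the unity of the
    ideal generated by [a], and [a] is a unit of that ideal with inverse
    [x \odot e = x^2 \odot a]; an inverse of [a] with respect to such an
    idempotent is a group inverse ([is_group_inverse_sqr]).  Conversely
    [a \odot z \odot a = a] reads [a = a^2 \odot z].

    If also [a = a^2 \odot y], then [x \odot a = a \odot y], both being equal to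
    [x \odot a^2 \odot y] ([circmul_sides_eq]); moving one factor across turns
    [x^2 \odot a] into [x \odot a \odot y] and then into [a \odot y^2]. *)

(** A group inverse is unique, so exhibiting one computes [group_inverse]. *)
Lemma group_inverseE (R : realType) (p : nat) (a z : 'cV[R]_p.+1) :
  is_group_inverse a z -> group_inverse a = z.
Proof.
move=> az; apply: (is_group_inverse_uniq _ az).
by apply: group_inverseP; exists z.
Qed.

(** With [e = x \odot a] idempotent and [e \odot a = a], the candidate is
    [x \odot e]: its product with [a] is [e], which fixes both of them. *)
Lemma is_group_inverse_sqr (R : realType) (p : nat) (a x : 'cV[R]_p.+1) :
  a = x \odot circsqr a -> is_group_inverse a (circsqr x \odot a).
Proof.
rewrite /circsqr circmulA -(circmulA x x a).
set e := x \odot a => ea.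
have ee : e \odot e = e.
  by rewrite {1}/e -circmulA [a \odot e]circmulC -ea.
have az : a \odot (x \odot e) = e.
  by rewrite circmulA [a \odot x]circmulC -/e ee.
have za : x \odot e \odot a = e by rewrite circmulC.
split; first by rewrite az -ea.
- by rewrite za circmulC -circmulA ee.
- by rewrite az za.
Qed.

(** Both sides equal [x \odot a^2 \odot y]. *)
Lemma circmul_sides_eq (R : realType) (p : nat) (a x y : 'cV[R]_p.+1) :
  a = x \odot circsqr a -> a = circsqr a \odot y -> x \odot a = a \odot y.
Proof. by move=> ax ay; rewrite {1}ay circmulA -ax. Qed.

Theorem theorem6 (R : realType) (p : nat) (a : 'cV[R]_p.+1) :
  (group_invertible a <-> circ_ideal (circsqr a) a) /\
  (forall x y : 'cV[R]_p.+1,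
     a = x \odot circsqr a -> a = circsqr a \odot y ->
     [/\ group_invertible a,
         group_inverse a = x \odot a \odot y,
         group_inverse a = circsqr x \odot a &
         group_inverse a = a \odot circsqr y]).
Proof.
split.
  split=> [[z [aza _ _]] | [x _ ax]].
    by exists z => //; rewrite /circsqr -circmulA circmulC.
  exists (circsqr x \odot a); apply: is_group_inverse_sqr.
  by rewrite circmulC ax.
move=> x y ax ay.
have az := is_group_inverse_sqr _ _ _ _ ax.
have xa := circmul_sides_eq _ _ _ _ _ ax ay.
have xay : circsqr x \odot a = x \odot a \odot y.
  by rewrite /circsqr -circmulA {1}xa circmulA.
split; first by exists (circsqr x \odot a).
- by rewrite (group_inverseE _ _ _ _ az).
- exact: group_inverseE az.
- by rewrite (group_inverseE _ _ _ _ az) xay xa -circmulA.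
Qed.
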